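(* Let $\mathcal V$ be a variety and $h$ a positive integer. The following conditions are equivalent. (i) Every algebra in $\mathcal V$ satisfies $\sigma\cap(\tau\circ\upsilon)\subseteq(\sigma\cap\tau)\circ_h(\sigma\cap\upsilon)$ for all U-admissible relations $\sigma,\tau,\upsilon$. (ii) Every algebra in $\mathcal V$ satisfies $\sigma\cap(\tau\circ\upsilon)\subseteq(\sigma\cap\tau)\circ_h(\sigma\cap\upsilon)$ for all reflexive and admissible relations $\sigma,\tau,\upsilon$. (iii) $\mathcal V$ has ternary terms $t_i$, $i=0,\dots,h$, and $4$-ary terms $s_i$ and $u_i$, $i=0,\dots,h-1$, such that the following identities hold throughout $\mathcal V$: $$x=t_0(x,y,z),\qquad t_h(x,y,z)=z,$$ $$t_i(x,y,z)=u_i(x,y,z;x),\quad u_i(x,y,z;z)=t_{i+1}(x,y,z)\quad\text{for } i<h,$$ $$t_i(x,y,z)=s_i(x,y,z;x),\quad s_i(x,y,z;y)=t_{i+1}(x,y,z)\quad\text{for even } i<h,$$ $$t_i(x,y,z)=s_i(x,y,z;y),\quad s_i(x,y,z;z)=t_{i+1}(x,y,z)\quad\text{for odd } i<h.$$ Moreover, each of these conditions holds in $\mathcal V$ if and only if it holds in $\mathbf F_{\mathcal V}(3)$.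
   Context: A binary relation on an algebra $\mathbf A$ is admissible if it is compatible with all operations. A relation is U-admissible if it is the set-theoretical union of some nonempty set of reflexive and admissible relations on $\mathbf A$. $\circ$ is relational composition and $S\circ_h T=S\circ T\circ S\circ\cdots$ is the alternating composition with $h$ factors in total, starting with $S$. $\mathbf F_{\mathcal V}(3)$ is the free algebra in $\mathcal V$ generated by 3 elements. The semicolon in $s_i(x,y,z;w)$ and $u_i(x,y,z;w)$ merely separates the fourth argument. *)

(* Defs.v *)
From mathcomp Require Import all_boot.
From mathcomp Require Import boolp classical_sets.

Set Implicit Arguments.
Unset Strict Implicit.
Unset Printing Implicit Defensive.

Local Open Scope classical_set_scope.
Local Open Scope quotient_scope.

Record signature := Signature {
  symbol : Type;
  arity : symbol -> nat
}.

Record algebra (Sg : signature) := Algebra {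
  carrier :> Type;
  op : forall f : symbol Sg, ('I_(arity f) -> carrier) -> carrier;
  carrier_inhabited : inhabited carrier
}.

(* [algebra Sg -> Prop] rather than [set (algebra Sg)]: the latter would force
   carriers into a universe strictly below that of [choiceType], hence exclude
   the quotient type used for free algebras. *)
Definition algebra_class (Sg : signature) := algebra Sg -> Prop.

Section Terms.
Variable Sg : signature.

Inductive term (X : Type) : Type :=
| Var of X
| App (f : symbol Sg) of ('I_(arity f) -> term X).

Fixpoint eval (A : algebra Sg) (X : Type) (v : X -> A) (t : term X) : A :=
  match t with
  | Var x => v x
  | App f ts => op (fun i => eval v (ts i))
  end.

Definition eval3 (A : algebra Sg) (t : term 'I_3) (x y z : A) : A :=
  eval (tnth [tuple x; y; z]) t.

Definition eval4 (A : algebra Sg) (t : term 'I_4) (x y z w : A) : A :=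
  eval (tnth [tuple x; y; z; w]) t.

Definition satisfies (A : algebra Sg) (X : Type) (s t : term X) : Prop :=
  forall v : X -> A, eval v s = eval v t.

(* A variety is an equational class; identities may use any finite number of
   variables, so they are written over the countable set [nat]. *)
Definition variety (V : algebra_class Sg) : Prop :=
  exists E : term nat -> term nat -> Prop,
    forall A, V A <-> (forall s t, E s t -> satisfies A s t).

Definition homomorphism (A B : algebra Sg) (phi : A -> B) : Prop :=
  forall (f : symbol Sg) (a : 'I_(arity f) -> A),
    phi (op a) = op (fun i => phi (a i)).

End Terms.

(* The free algebra over X in V: terms over X modulo the identities that hold
   throughout V. *)
Section FreeAlgebra.
Variables (Sg : signature) (V : algebra_class Sg) (X : Type).
Hypothesis X_inhabited : inhabited X.

Definition free_rel : rel {classic (term Sg X)} :=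
  fun s t => `[< forall A, V A -> satisfies A s t >].

Lemma free_rel_refl : reflexive free_rel.
Proof. by move=> t; apply/asboolP => A _ v. Qed.

Lemma free_rel_sym : symmetric free_rel.
Proof. by move=> s t; apply/asboolP/asboolP => H A VA v; rewrite H. Qed.

Lemma free_rel_trans : transitive free_rel.
Proof.
move=> t s u /asboolP st /asboolP tu; apply/asboolP => A VA v.
by rewrite st // tu.
Qed.

Canonical free_equiv :=
  EquivRel free_rel free_rel_refl free_rel_sym free_rel_trans.

Definition free_carrier : Type := {eq_quot free_equiv}.

Definition free_class (t : term Sg X) : free_carrier :=
  \pi_({eq_quot free_equiv}) (t : {classic (term Sg X)}).

Definition free_repr (a : free_carrier) : term Sg X :=
  repr (a : {eq_quot free_equiv}).

Definition free_op (f : symbol Sg) (a : 'I_(arity f) -> free_carrier) :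
    free_carrier :=
  free_class (App (fun i => free_repr (a i))).

Lemma free_inhabited : inhabited free_carrier.
Proof. by case: X_inhabited => x; split; exact: free_class (Var Sg x). Qed.

Definition free_algebra : algebra Sg := Algebra free_op free_inhabited.

Definition free_gen (x : X) : free_algebra := free_class (Var Sg x).

Lemma free_reprK (a : free_carrier) : free_class (free_repr a) = a.
Proof. exact: reprK. Qed.

Lemma free_classP (s t : term Sg X) :
  free_class s = free_class t <-> forall A, V A -> satisfies A s t.
Proof.
split=> [/(@eqquotP _ _ {eq_quot free_equiv})/asboolP //|st].
by apply/(@eqquotP _ _ {eq_quot free_equiv})/asboolP.
Qed.

Lemma free_op_class (f : symbol Sg) (ts : 'I_(arity f) -> term Sg X) :
  free_op (fun i => free_class (ts i)) = free_class (App ts).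
Proof.
apply/free_classP => A VA v /=; congr op; apply: funext => i.
by move: A VA v; apply/free_classP; rewrite free_reprK.
Qed.

Lemma eval_free_gen (t : term Sg X) : eval free_gen t = free_class t.
Proof.
elim: t => [//|f ts IH] /=; rewrite -free_op_class.
by congr free_op; apply: funext => i; exact: IH.
Qed.

Lemma free_generated (a : free_algebra) : exists t, a = eval free_gen t.
Proof. by exists (free_repr a); rewrite eval_free_gen free_reprK. Qed.

Lemma free_universal (A : algebra Sg) (v : X -> A) : V A ->
  exists phi : free_algebra -> A,
    homomorphism phi /\ forall x, phi (free_gen x) = v x.
Proof.
move=> VA.
have evalK t : eval v (free_repr (free_class t)) = eval v t.
  by move: A VA v; apply/free_classP; rewrite free_reprK.
exists (fun a => eval v (free_repr a)); split=> [f a|x]; last exact: evalK.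
exact: evalK.
Qed.

Fixpoint subst (Y : Type) (g : Y -> term Sg X) (t : term Sg Y) : term Sg X :=
  match t with
  | Var y => g y
  | App f ts => App (fun i => subst g (ts i))
  end.

Lemma eval_subst (Y : Type) (g : Y -> term Sg X) (A : algebra Sg) (v : X -> A)
    (t : term Sg Y) :
  eval v (subst g t) = eval (fun y => eval v (g y)) t.
Proof.
by elim: t => [//|f ts IH] /=; congr op; apply: funext => i; exact: IH.
Qed.

Lemma eval_free (Y : Type) (v : Y -> free_algebra) (t : term Sg Y) :
  eval v t = free_class (subst (fun y => free_repr (v y)) t).
Proof.
elim: t => [y|f ts IH] /=; first by rewrite free_reprK.
by rewrite -free_op_class; congr free_op; apply: funext => i; exact: IH.
Qed.

Lemma free_in_variety : variety V -> V free_algebra.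
Proof.
case=> E VE; apply/VE => s t Est v; rewrite !eval_free.
apply/free_classP => A /VE AE w.
by rewrite !eval_subst; exact: AE.
Qed.

End FreeAlgebra.

Definition free_algebra3 (Sg : signature) (V : algebra_class Sg) : algebra Sg :=
  free_algebra V (inhabits (ord0 : 'I_3)).

Section Relations.
Variables (Sg : signature) (A : algebra Sg).
Implicit Types R S T : set (A * A).

Definition reflexive_relation R : Prop := forall x, R (x, x).

Definition admissible R : Prop :=
  forall (f : symbol Sg) (a b : 'I_(arity f) -> A),
    (forall i, R (a i, b i)) -> R (op a, op b).

Definition U_admissible R : Prop :=
  exists F : set (set (A * A)),
    [/\ F !=set0,
        (forall S, F S -> reflexive_relation S /\ admissible S)
      & R = \bigcup_(S in F) S].

(* First S, then T; the library's [T \; S] relates along S first. *)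
Definition comp_rel S T : set (A * A) := (T \; S)%relation.

(* h factors S, T, S, ... in total; the product of no factors is the identity. *)
Fixpoint alt_comp (h : nat) S T : set (A * A) :=
  match h with
  | 0 => diagonal
  | k.+1 => comp_rel S (alt_comp k T S)
  end.

Definition distributive_inclusion (h : nat) (sigma tau upsilon : set (A * A)) :=
  sigma `&` comp_rel tau upsilon
    `<=` alt_comp h (sigma `&` tau) (sigma `&` upsilon).

End Relations.

Section Conditions.
Variables (Sg : signature) (K : algebra_class Sg) (h : nat).

Definition condition_i : Prop :=
  forall A, K A -> forall sigma tau upsilon : set (A * A),
    U_admissible sigma -> U_admissible tau -> U_admissible upsilon ->
    distributive_inclusion h sigma tau upsilon.

Definition condition_ii : Prop :=
  forall A, K A -> forall sigma tau upsilon : set (A * A),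
    reflexive_relation sigma -> admissible sigma ->
    reflexive_relation tau -> admissible tau ->
    reflexive_relation upsilon -> admissible upsilon ->
    distributive_inclusion h sigma tau upsilon.

(* Only t 0, ..., t h and s i, u i with i < h are constrained. *)
Definition condition_iii : Prop :=
  exists (t : nat -> term Sg 'I_3) (s u : nat -> term Sg 'I_4),
  forall A, K A -> forall x y z : A,
    [/\ x = eval3 (t 0) x y z,
        eval3 (t h) x y z = z,
        forall i, i < h ->
          eval3 (t i) x y z = eval4 (u i) x y z x /\
          eval4 (u i) x y z z = eval3 (t i.+1) x y z,
        forall i, i < h -> ~~ odd i ->
          eval3 (t i) x y z = eval4 (s i) x y z x /\
          eval4 (s i) x y z y = eval3 (t i.+1) x y z
      & forall i, i < h -> odd i ->
          eval3 (t i) x y z = eval4 (s i) x y z y /\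
          eval4 (s i) x y z z = eval3 (t i.+1) x y z].

End Conditions.

Definition only (Sg : signature) (A : algebra Sg) : algebra_class Sg :=
  fun B => B = A.

(* Main.v *)
Require Import Defs.
From mathcomp Require Import all_boot.
From mathcomp Require Import boolp classical_sets.

Set Implicit Arguments.
Unset Strict Implicit.
Unset Printing Implicit Defensive.

(** The identities of (iii), read at one triple [x, y, z] of an algebra, say
    that [t 0, ..., t h] is a path from [x] to [z] whose every step comes from
    replacing the last argument of a 4-ary term: [x] by [z] in [u i], and in
    [s i] alternately [x] by [y] and [y] by [z].

    A reflexive admissible relation that contains [(x, z)] therefore contains
    every step of the path, and one that contains [(x, y)], resp. [(y, z)],
    contains every even, resp. odd, step.  So the path witnesses the inclusion
    of (ii) for any [(x, z)] in the left-hand side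
    ([inclusion_of_distributive_path]).  Since membership in a U-admissible
    relation is membership in one of its reflexive admissible members, the same
    path proves (i).

    Conversely, in the algebra freely generated by [x, y, z], the pairs
    [(w(x,y,z;p), w(x,y,z;q))] form a reflexive admissible relation containing
    [(p, q)].  Applying (ii) to the three relations obtained from [(x, z)],
    [(x, y)] and [(y, z)] gives a path from [x] to [z], and the meaning of
    membership in these relations is exactly that the path satisfies the
    identities of (iii) at the generators ([distributive_path_of_condition_ii]).
    A homomorphism carries such a path to any triple of any algebra in the
    variety, which is (iii).

    This loop uses (ii) only in the free algebra, which lies in the variety, so
    it yields the comparison with the free algebra as well. *)

(** * Terms, homomorphisms and admissible relations *)

Lemma eval_hom (Sg : signature) (A B : algebra Sg) (phi : A -> B) (X : Type)
    (v : X -> A) (t : term Sg X) :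
  homomorphism phi -> phi (eval v t) = eval (phi \o v) t.
Proof.
move=> phiM; elim: t => [//|f ts IH] /=; rewrite phiM.
by congr op; apply: funext => i; exact: IH.
Qed.

Lemma eval3_hom (Sg : signature) (A B : algebra Sg) (phi : A -> B)
    (t : term Sg 'I_3) (x y z : A) :
  homomorphism phi -> phi (eval3 t x y z) = eval3 t (phi x) (phi y) (phi z).
Proof.
move=> phiM; rewrite /eval3 eval_hom //; congr (eval _ t); apply: funext.
by case=> [[|[|[|//]]] ilt].
Qed.

Lemma eval4_hom (Sg : signature) (A B : algebra Sg) (phi : A -> B)
    (t : term Sg 'I_4) (x y z w : A) :
  homomorphism phi ->
  phi (eval4 t x y z w) = eval4 t (phi x) (phi y) (phi z) (phi w).
Proof.
move=> phiM; rewrite /eval4 eval_hom //; congr (eval _ t); apply: funext.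
by case=> [[|[|[|[|//]]]] ilt].
Qed.

Lemma admissible_eval (Sg : signature) (A : algebra Sg) (R : set (A * A))
    (X : Type) (v w : X -> A) (t : term Sg X) :
  admissible R -> (forall x, R (v x, w x)) -> R (eval v t, eval w t).
Proof. by move=> Radm Rvw; elim: t => [//|f ts IH] /=; exact: Radm. Qed.

Lemma admissible_eval4 (Sg : signature) (A : algebra Sg) (R : set (A * A))
    (t : term Sg 'I_4) (x y z p q : A) :
  reflexive_relation R -> admissible R -> R (p, q) ->
  R (eval4 t x y z p, eval4 t x y z q).
Proof.
move=> Rrefl Radm Rpq; apply: admissible_eval => // -[[|[|[|[|//]]]] ilt].
- exact: Rrefl.
- exact: Rrefl.
- exact: Rrefl.
- exact: Rpq.
Qed.

Lemma admissible_U_admissible (Sg : signature) (A : algebra Sg)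
    (R : set (A * A)) :
  reflexive_relation R -> admissible R -> U_admissible R.
Proof.
move=> Rrefl Radm; exists [set R]%classic; split; first by exists R.
- by move=> _ ->.
- by rewrite bigcup_set1.
Qed.

Lemma U_admissible_member (Sg : signature) (A : algebra Sg) (R : set (A * A))
    (ab : A * A) :
  U_admissible R -> R ab ->
  exists R', [/\ reflexive_relation R', admissible R', R' ab
                 & (R' `<=` R)%classic].
Proof.
case=> F [_ Fadm ->] [R' FR' R'ab]; have [R'refl R'adm] := Fadm _ FR'.
by exists R'; split=> //; exact: bigcup_sup.
Qed.

Lemma alt_compP (Sg : signature) (A : algebra Sg) (h : nat) (S T : set (A * A))
    (a b : A) :
  alt_comp h S T (a, b) <->
  exists c : nat -> A, [/\ c 0 = a, c h = b
    & forall i, i < h -> (if odd i then T else S) (c i, c i.+1)].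
Proof.
elim: h S T a => [|h IH] S T a /=.
  split=> [ab|[c [<- <- _]] //].
  by exists (fun=> a); split.
split=> [[d Sad /IH [c [c0 ch step]]]|[c [c0 ch step]]].
  exists (fun i => if i is j.+1 then c j else a); split=> //.
  case=> [|i] /= ih; first by rewrite c0.
  by have := step i ih; case: (odd i).
exists (c 1); first by rewrite /= -c0; exact: (step 0).
apply/IH; exists (fun i => c i.+1); split=> // i ih.
(* Dropping the first step shifts indices by one, which swaps [S] and [T]. *)
by have := step i.+1 ih; rewrite /=; case: (odd i).
Qed.

(** * Paths of terms at a triple of elements *)

(** The identities of (iii), evaluated at a single triple: this local form is
    what can be produced at the generators of a free algebra and then
    transported along homomorphisms. *)
Definition distributive_path (Sg : signature) (h : nat)
    (t : nat -> term Sg 'I_3) (s u : nat -> term Sg 'I_4)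
    (A : algebra Sg) (x y z : A) : Prop :=
  [/\ x = eval3 (t 0) x y z,
      eval3 (t h) x y z = z,
      forall i, i < h ->
        eval3 (t i) x y z = eval4 (u i) x y z x /\
        eval4 (u i) x y z z = eval3 (t i.+1) x y z,
      forall i, i < h -> ~~ odd i ->
        eval3 (t i) x y z = eval4 (s i) x y z x /\
        eval4 (s i) x y z y = eval3 (t i.+1) x y z
    & forall i, i < h -> odd i ->
        eval3 (t i) x y z = eval4 (s i) x y z y /\
        eval4 (s i) x y z z = eval3 (t i.+1) x y z].

Lemma distributive_path_hom (Sg : signature) (h : nat)
    (t : nat -> term Sg 'I_3) (s u : nat -> term Sg 'I_4)
    (A B : algebra Sg) (phi : A -> B) (x y z : A) :
  homomorphism phi -> distributive_path h t s u x y z ->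
  distributive_path h t s u (phi x) (phi y) (phi z).
Proof.
move=> phiM [t0 th tu tse tso].
split=> [||i ih|i ih i_even|i ih i_odd]; rewrite -!(eval3_hom, eval4_hom) //.
- by rewrite -t0.
- by rewrite th.
- by have [-> ->] := tu i ih.
- by have [-> ->] := tse i ih i_even.
- by have [-> ->] := tso i ih i_odd.
Qed.

(** One path serves all triples of relations at once; in particular it depends
    only on [x, y, z], not on which members of a U-admissible relation contain
    the given pairs. *)
Lemma inclusion_of_distributive_path (Sg : signature) (h : nat)
    (t : nat -> term Sg 'I_3) (s u : nat -> term Sg 'I_4)
    (A : algebra Sg) (x y z : A) (sigma tau upsilon : set (A * A)) :
  distributive_path h t s u x y z ->
  U_admissible sigma -> U_admissible tau -> U_admissible upsilon ->
  sigma (x, z) -> tau (x, y) -> upsilon (y, z) ->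
  alt_comp h (sigma `&` tau)%classic (sigma `&` upsilon)%classic (x, z).
Proof.
move=> [t0 th tu tse tso] sigmaU tauU upsilonU.
move=> /(U_admissible_member sigmaU) [S [Srefl Sadm Sxz sub_sigma]].
move=> /(U_admissible_member tauU) [T [Trefl Tadm Txy sub_tau]].
move=> /(U_admissible_member upsilonU) [P [Prefl Padm Pyz sub_upsilon]].
apply/alt_compP; exists (fun i => eval3 (t i) x y z); split=> // i ih.
have sigma_step : sigma (eval3 (t i) x y z, eval3 (t i.+1) x y z).
  by have [-> <-] := tu i ih; apply: sub_sigma; exact: admissible_eval4.
case: (boolP (odd i)) => i_parity; split=> //.
- have [-> <-] := tso i ih i_parity.
  by apply: sub_upsilon; exact: admissible_eval4.
- have [-> <-] := tse i ih i_parity.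
  by apply: sub_tau; exact: admissible_eval4.
Qed.

(** * Relations generated by a pair in a three-generated algebra *)

Section Translates.
Variables (Sg : signature) (A : algebra Sg) (x y z : A).

(** When [x, y, z] generate [A], this is the least reflexive admissible relation
    containing [(p, q)]. *)
Definition translates (p q : A) : set (A * A) :=
  fun ab => exists w : term Sg 'I_4,
    ab.1 = eval4 w x y z p /\ ab.2 = eval4 w x y z q.

Lemma translates_pair (p q : A) : translates p q (p, q).
Proof. by exists (Var Sg (@Ordinal 4 3 isT)). Qed.

Lemma translates_admissible (p q : A) : admissible (translates p q).
Proof.
move=> f a b /choice [ws wsP]; exists (App ws).
rewrite /eval4 /=; split; congr op; apply: funext => i.
- by case: (wsP i).
- by case: (wsP i).
Qed.

Hypothesis xyz_generate : forall a : A, exists t, a = eval3 t x y z.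

Lemma translates_reflexive (p q : A) : reflexive_relation (translates p q).
Proof.
move=> a; have [t ->] := xyz_generate a.
pose lift4 := subst (fun j : 'I_3 => Var Sg (widen_ord (isT : 3 <= 4) j)).
have lift4E r : eval3 t x y z = eval4 (lift4 t) x y z r.
  rewrite /eval4 eval_subst; congr (eval _ t); apply: funext.
  by case=> [[|[|[|//]]] ilt].
by exists (lift4 t); split; exact: lift4E.
Qed.

(** Intersecting with [translates x z] supplies the terms [u i], and the factor
    [translates x y] or [translates y z], according to parity, the [s i]. *)
Lemma distributive_path_of_condition_ii (h : nat) :
  condition_ii (only A) h ->
  exists t s u, distributive_path h t s u x y z.
Proof.
move=> /(_ A erefl (translates x z) (translates x y) (translates y z)).
move=> /(_ (translates_reflexive _ _) (@translates_admissible _ _)).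
move=> /(_ (translates_reflexive _ _) (@translates_admissible _ _)).
move=> /(_ (translates_reflexive _ _) (@translates_admissible _ _) (x, z)).
move=> inclusion_at_xz.
have /inclusion_at_xz /alt_compP [c [c0 ch step]] :
    (translates x z `&` comp_rel (translates x y) (translates y z))%classic
      (x, z).
  split; first exact: translates_pair.
  by exists y; exact: translates_pair.
have [t tE] := choice (fun i => xyz_generate (c i)).
(* [choice] needs terms at every index; past the path any variable will do. *)
(* Choice needs a term at every index; past the path any variable will do. *)
have /choice [u uE] i : exists w : term Sg 'I_4, i < h ->
    c i = eval4 w x y z x /\ c i.+1 = eval4 w x y z z.
  case: (ltnP i h) => [ih|]; last by exists (Var Sg ord0).
  have /= := step i ih.
  by case: (odd i) => -[[w [? ?]] _]; exists w.
have /choice [s sE] i : exists w : term Sg 'I_4, i < h ->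
    if odd i then c i = eval4 w x y z y /\ c i.+1 = eval4 w x y z z
    else c i = eval4 w x y z x /\ c i.+1 = eval4 w x y z y.
  case: (ltnP i h) => [ih|]; last by exists (Var Sg ord0).
  have /= := step i ih.
  by case: (odd i) => -[_ [w [? ?]]]; exists w.
exists t, s, u; split=> [||i ih|i ih i_even|i ih i_odd]; rewrite -!tE //.
- by have [-> ->] := uE i ih.
- by have := sE i ih; rewrite (negbTE i_even) => -[-> ->].
- by have := sE i ih; rewrite i_odd => -[-> ->].
Qed.

End Translates.

(** * The free algebra on three generators *)

Section FreeThree.
Variables (Sg : signature) (V : algebra_class Sg).

Let gen (j : 'I_3) : free_algebra3 V := free_gen V (inhabits (ord0 : 'I_3)) j.
Let x := gen (@Ordinal 3 0 isT).
Let y := gen (@Ordinal 3 1 isT).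
Let z := gen (@Ordinal 3 2 isT).

Lemma free3_generated (a : free_algebra3 V) : exists t, a = eval3 t x y z.
Proof.
have [t ->] := free_generated a; exists t.
rewrite /eval3; congr (eval _ t); apply: funext.
by case=> [[|[|[|//]]] ilt]; congr free_gen; exact: val_inj.
Qed.

Lemma free3_universal (B : algebra Sg) (a b c : B) : V B ->
  exists phi : free_algebra3 V -> B,
    [/\ homomorphism phi, phi x = a, phi y = b & phi z = c].
Proof.
move=> VB.
have [phi [phiM phi_gen]] :=
  free_universal (inhabits (ord0 : 'I_3)) (tnth [tuple a; b; c]) VB.
by exists phi; split=> //; rewrite /x /y /z phi_gen.
Qed.

Lemma condition_iii_of_free3_ii (h : nat) :
  condition_ii (only (free_algebra3 V)) h -> condition_iii V h.
Proof.
move=> /(distributive_path_of_condition_ii free3_generated) [t [s [u path]]].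
exists t, s, u => B VB a b c.
have [phi [phiM <- <- <-]] := free3_universal a b c VB.
exact: (distributive_path_hom phiM path).
Qed.

End FreeThree.

(** * The equivalences *)

Section Implications.
Variables (Sg : signature) (h : nat).

Lemma condition_i_ii (K : algebra_class Sg) :
  condition_i K h -> condition_ii K h.
Proof.
move=> K_i A KA sigma tau upsilon *.
by apply: K_i => //; exact: admissible_U_admissible.
Qed.

Lemma condition_iii_i (K : algebra_class Sg) :
  condition_iii K h -> condition_i K h.
Proof.
move=> [t [s [u paths]]] A KA sigma tau upsilon sigmaU tauU upsilonU [x z].
move=> [sigma_xz [y tau_xy upsilon_yz]].
exact: (inclusion_of_distributive_path (paths A KA x y z)).
Qed.

End Implications.

Theorem proposition3p7 (Sg : signature) (V : algebra_class Sg) (h : nat)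
    (V_variety : variety V) (h_gt0 : 0 < h) :
  [/\ condition_i V h <-> condition_ii V h,
      condition_ii V h <-> condition_iii V h
    & [/\ condition_i V h <-> condition_i (only (free_algebra3 V)) h,
          condition_ii V h <-> condition_ii (only (free_algebra3 V)) h
        & condition_iii V h <-> condition_iii (only (free_algebra3 V)) h]].
Proof.
set F := only (free_algebra3 V).
have VF A : F A -> V A by move=> ->; exact: free_in_variety.
have restrict_i : condition_i V h -> condition_i F h.
  by move=> V_i A /VF; exact: V_i.
have restrict_ii : condition_ii V h -> condition_ii F h.
  by move=> V_ii A /VF; exact: V_ii.
have restrict_iii : condition_iii V h -> condition_iii F h.
  by move=> [t [s [u paths]]]; exists t, s, u => A /VF; exact: paths.
have V_i_ii : condition_i V h -> condition_ii V h by exact: condition_i_ii.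
have V_iii_i : condition_iii V h -> condition_i V h by exact: condition_iii_i.
have F_i_ii : condition_i F h -> condition_ii F h by exact: condition_i_ii.
have F_iii_i : condition_iii F h -> condition_i F h by exact: condition_iii_i.
have F_ii_V_iii : condition_ii F h -> condition_iii V h.
  exact: condition_iii_of_free3_ii.
by split; [| |split]; split; auto.
Qed.
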